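(* Let $p,q$ be co-prime positive integers, $N\ge 2$ an integer, $x_0,y_0$ nonzero real numbers and $\varphi_x,\varphi_y\in\mathbb{R}$. a) Consider a formation of Type I or Type II with these parameters moving without collisions. If at least one of $p,q$ is even, then $w_{i,j}=0$ for all pairs $i\neq j$. Otherwise (both $p,q$ odd), $w_{i,j}=\pm1$ for all pairs $i\ne j$ (the sign may depend on the pair). Consequently, if both $p,q$ are odd, then the formation is weakly entangled. b) Consider a formation of Type I with these parameters moving without collisions and suppose that both $p,q$ are odd (so that $w_{i,j}=\pm 1$ for all pairs $i\ne j$). Then both values $+1$ and $-1$ are encountered among the winding numbers $w_{i,j}$ if and only if neither of the numbers $q-p$, $q+p$ is divisible by $2N$. As a consequence, if neither of $q-p$, $q+p$ is divisible by $2N$, then the formation is strongly entangled.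
   Context: A formation is a family of $N$ planar trajectories $\tau\mapsto(x_i(\tau),y_i(\tau))$, $i=1,\dots,N$. Type I formation: $$x_i(\tau)=x_0\sin\left[2\pi p\left(\tau+\tfrac{i}{N}\right)+\varphi_x\right],\qquad y_i(\tau)=y_0\sin\left[2\pi q\left(\tau+\tfrac{i}{N}\right)+\varphi_y\right].$$ Type II formation: $$x_i(\tau)=x_0\sin\left[2\pi\left(p\tau+\tfrac{i}{N}\right)+\varphi_x\right],\qquad y_i(\tau)=y_0\sin\left[2\pi\left(q\tau+\tfrac{i}{N}\right)+\varphi_y\right].$$ Both have period $1$ in $\tau$. The formation moves without collisions if $(x_i(\tau),y_i(\tau))\neq(x_j(\tau),y_j(\tau))$ for all $\tau$ and all $i\ne j$. Winding numbers. For a formation without collisions and $i\neq j$, $w_{i,j}$ is the number of turns the $j$-th satellite makes about the $i$-th over the period: $$w_{i,j}=\frac{1}{2\pi}\arg\begin{pmatrix}x_j(\tau)-x_i(\tau)\\ y_j(\tau)-y_i(\tau)\end{pmatrix}\Big|_{\tau=0}^{1},$$ where $\arg$ is a continuous choice of the polar angle of the (nonvanishing) vector along $\tau\in[0,1]$. Thus $w_{i,j}$ is an integer and $w_{i,j}=w_{j,i}$. Entanglement. Regard the formation as the continuous map $\mathcal{M}_0(\tau)=\big((x_1(\tau),y_1(\tau)),\dots,(x_N(\tau),y_N(\tau))\big)$, $\tau\in[0,1]$, with values in the space of $N$-tuples of pairwise distinct points of $\mathbb{R}^2$; it satisfies $\mathcal{M}_0(0)=\mathcal{M}_0(1)$.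 Let $\mathcal{M}_1(\tau)=\mathcal{M}_0(0)$ for all $\tau\in[0,1]$ be the constant map. $\mathcal{M}_0$ is strongly homotopic to $\mathcal{M}_1$ if there is a continuous family $\mathcal{M}_\alpha(\tau)$, $(\alpha,\tau)\in[0,1]^2$, of $N$-tuples of pairwise distinct points of $\mathbb{R}^2$ (i.e. without collisions), which equals $\mathcal{M}_0$ for $\alpha=0$ and $\mathcal{M}_1$ for $\alpha=1$, and satisfies $\mathcal{M}_\alpha(0)=\mathcal{M}_\alpha(1)$ for all $\alpha\in[0,1]$. The formation is weakly entangled if $\mathcal{M}_0$ is not strongly homotopic to $\mathcal{M}_1$. $\mathcal{M}_0$ is weakly homotopic to $\mathcal{M}_1$ if there is such a continuous collision-free family where the last constraint is replaced by $\mathcal{M}_\alpha(0)=R_{\varphi(\alpha)}\mathcal{M}_\alpha(1)$ for all $\alpha\in[0,1]$, for some continuous function $\varphi:[0,1]\to\mathbb{R}$, where $R_\theta$ denotes the rotation of all $N$ points in the plane about the origin by the common angle $\theta$. The formation is strongly entangled if $\mathcal{M}_0$ is not weakly homotopic to $\mathcal{M}_1$. *)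

(* Defs.v *)
From HB Require Import structures.
From mathcomp Require Import all_boot all_order all_algebra.
From mathcomp Require Import all_classical all_reals all_analysis.

Set Implicit Arguments.
Unset Strict Implicit.
Unset Printing Implicit Defensive.

Import Order.TTheory GRing.Theory Num.Theory.
Import numFieldNormedType.Exports.

Local Open Scope classical_set_scope.
Local Open Scope ring_scope.

(* A configuration of N points of the plane has type ['I_N -> R * R]; since
   ['I_N] is {0, ..., N-1}, the point with index i = 1, ..., N is [i.-1],
   whence the [i.+1] in the two families below. *)

Definition type_I (R : realType) (p q N : nat) (x0 y0 phx phy : R)
    (tau : R) (i : 'I_N) : R * R :=
  (x0 * sin (2 * pi * p%:R * (tau + i.+1%:R / N%:R) + phx),
   y0 * sin (2 * pi * q%:R * (tau + i.+1%:R / N%:R) + phy)).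

Definition type_II (R : realType) (p q N : nat) (x0 y0 phx phy : R)
    (tau : R) (i : 'I_N) : R * R :=
  (x0 * sin (2 * pi * (p%:R * tau + i.+1%:R / N%:R) + phx),
   y0 * sin (2 * pi * (q%:R * tau + i.+1%:R / N%:R) + phy)).

Definition without_collisions (R : realType) (N : nat)
    (M : R -> 'I_N -> R * R) : Prop :=
  forall (tau : R) (i j : 'I_N), i != j -> M tau i <> M tau j.

Definition polar_angle (R : realType) (v : R * R) (theta : R) : Prop :=
  exists2 r : R, 0 < r & v = (r * cos theta, r * sin theta).

Definition continuous_arg (R : realType) (u : R -> R * R)
    (theta : R -> R) : Prop :=
  {within `[0, 1], continuous theta} /\
  forall tau : R, 0 <= tau <= 1 -> polar_angle (u tau) (theta tau).

(* The increment does not depend on the choice of the continuous argument,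
   so the set below has at most one element. The default 1/2, used only when
   there is no continuous argument on [0, 1], is not an integer: it is never
   the number of turns of a closed curve. *)
Definition turns (R : realType) (u : R -> R * R) : R :=
  xget 2^-1 [set w : R | exists2 theta : R -> R, continuous_arg u theta &
                           w = (theta 1 - theta 0) / (2 * pi)].

Definition winding_number (R : realType) (N : nat)
    (M : R -> 'I_N -> R * R) (i j : 'I_N) : R :=
  turns (fun tau => M tau j - M tau i).

(* Continuity of each of the N points on [0, 1]^2 is continuity for the
   product topology on N-tuples; injectivity of [H a tau] says that its N
   points are pairwise distinct. *)
Definition collision_free_family (R : realType) (N : nat)
    (M0 M1 : R -> 'I_N -> R * R) (H : R -> R -> 'I_N -> R * R) : Prop :=
  [/\ forall i : 'I_N, {within (`[0, 1] `*` `[0, 1] : set (R * R)),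
                          continuous (fun z : R * R => H z.1 z.2 i)},
      forall a tau : R, 0 <= a <= 1 -> 0 <= tau <= 1 -> injective (H a tau),
      forall tau : R, 0 <= tau <= 1 -> H 0 tau =1 M0 tau &
      forall tau : R, 0 <= tau <= 1 -> H 1 tau =1 M1 tau].

Definition rotation (R : realType) (theta : R) (v : R * R) : R * R :=
  (cos theta * v.1 - sin theta * v.2, sin theta * v.1 + cos theta * v.2).

Definition strongly_homotopic (R : realType) (N : nat)
    (M0 M1 : R -> 'I_N -> R * R) : Prop :=
  exists H : R -> R -> 'I_N -> R * R,
    collision_free_family M0 M1 H /\
    forall a : R, 0 <= a <= 1 -> H a 0 =1 H a 1.

Definition weakly_homotopic (R : realType) (N : nat)
    (M0 M1 : R -> 'I_N -> R * R) : Prop :=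
  exists (H : R -> R -> 'I_N -> R * R) (phi : R -> R),
    [/\ collision_free_family M0 M1 H,
        {within `[0, 1], continuous phi} &
        forall a : R, 0 <= a <= 1 ->
          forall i : 'I_N, H a 0 i = rotation (phi a) (H a 1 i)].

(* The adverbs swap: weak entanglement negates strong homotopy, and strong
   entanglement negates weak homotopy. *)
Definition weakly_entangled (R : realType) (N : nat)
    (M : R -> 'I_N -> R * R) : Prop :=
  ~ strongly_homotopic M (fun=> M 0).

Definition strongly_entangled (R : realType) (N : nat)
    (M : R -> 'I_N -> R * R) : Prop :=
  ~ weakly_homotopic M (fun=> M 0).

(* Main.v *)
Require Import Defs.
From HB Require Import structures.
From mathcomp Require Import all_boot all_order all_algebra.
From mathcomp Require Import all_classical all_reals all_analysis.
From mathcomp Require Import ring lra.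

Set Implicit Arguments.
Unset Strict Implicit.
Unset Printing Implicit Defensive.

Import Order.TTheory GRing.Theory Num.Theory.
Import numFieldNormedType.Exports.

Local Open Scope classical_set_scope.
Local Open Scope ring_scope.

(** A pair of points of a formation has as its difference a Lissajous curve
    (A sin(2 pi p t + a), B sin(2 pi q t + b)) that avoids the origin
    ([difference_lissajous]), so the theorem is about the number of turns of such
    curves.

    If p or q is even, then half a period later the curve is reflected in one of
    the axes, and the turns of its two halves cancel ([turns_lissajous_even]).

    If both are odd, then the number of turns is the sign of
    - A B sin(p b - q a) ([turns_lissajous_odd]). By a translation of time and
    changes of sign of the coordinates one may assume that a = 0 and that b lies
    between 0 and pi / p. The polar angle is then followed from one zero k / 2p of
    the first coordinate to the next: it changes by pi, 0 or - pi, according to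
    the signs of the second coordinate at both ends. The sum of these changes
    is an alternating sum of signs, and it can be evaluated because k |-> q k
    permutes the residues modulo p ([turns_lissajous_in_phase]).

    For a formation of Type I the phase p b - q a is the same for all pairs. Hence
    the winding number of points i and j is, up to a common sign, the sign of
    sin(pi p m / N) sin(pi q m / N) with m = j - i ([winding_number_type_I]). If
    2N divides neither q - p nor q + p, then these products sum to 0 over m
    ([sum_sin_product]), and none with 0 < m < N vanishes, so both signs occur.
    If 2N divides one of these numbers, then the two sines agree for all m, or
    are opposite for all m, and all winding numbers are equal.

    The statements about entanglement need the polar angle to be lifted along a
    homotopy ([lifting]). Along a weak homotopy with rotation angle phi, the
    increment of the lifted angle plus phi is a multiple of 2 pi that varies
    continuously, so it is constant. A homotopy to the constant formation thus
    makes all winding numbers equal to (phi 1 - phi 0) / 2 pi, which is 0 for a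
    strong homotopy ([winding_number_homotopy]). *)

(** * Polar angles and their increments *)

Section Angles.
Variable R : realType.
Implicit Types (x y t theta : R) (u v w : R * R) (f : R -> R).

Lemma sin_addnpi x (n : int) : sin (x + pi * n%:~R) = (-1) ^ n * sin x.
Proof.
case: n => n /=.
  by rewrite -[n%:~R]/(n%:R) mulr_natr (alternatingn (@sinDpi R)).
rewrite NegzE mulrNz mulrN -[X in _ = _ * sin X](subrK (pi * n.+1%:R)).
rewrite [X in _ * sin (_ + X)]mulr_natr (alternatingn (@sinDpi R)) mulrA.
by rewrite -exprnN -exprVn invrN1 -exprMn mulrNN mulr1 expr1n mul1r.
Qed.

Lemma cos_addnpi x (n : int) : cos (x + pi * n%:~R) = (-1) ^ n * cos x.
Proof. by rewrite -sinDpihalf addrAC sin_addnpi sinDpihalf. Qed.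

Lemma mod_pi x : exists (n : int) (y : R), x = y + pi * n%:~R /\ 0 <= y < pi.
Proof.
have pi0 := pi_gt0 R.
exists (Num.floor (x / pi)), (x - pi * (Num.floor (x / pi))%:~R).
split; first by ring.
have /andP[] := floor_itv (x / pi).
rewrite ler_pdivlMr// ltr_pdivrMr// intrD mulrDl => h1 h2.
by rewrite subr_ge0 mulrC h1 /= ltrBlDr mulrC; move: h2; lra.
Qed.

Lemma sin_eq0 x : sin x = 0 -> exists n : int, x = pi * n%:~R.
Proof.
have [n [y [-> /andP[y0 ypi]]]] := mod_pi x => sin0; exists n.
move: sin0; rewrite sin_addnpi => /eqP; rewrite mulf_eq0 expfz_eq0.
rewrite oppr_eq0 oner_eq0 andbF /=; move: y0; rewrite le_eqVlt.
move=> /predU1P[<-|y0]; first by rewrite add0r.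
by rewrite gt_eqF// sin_gt0_pi// y0.
Qed.

Lemma cos_eq1 x : cos x = 1 -> `|x| < 2 * pi -> x = 0.
Proof.
move=> c1 xb; have : sin x = 0 by apply: cos1sin0; rewrite c1 normr1.
move=> /sin_eq0[n xE]; rewrite xE in c1 xb *; have pi0 := pi_gt0 R.
move: c1; rewrite -[X in cos X]add0r cos_addnpi cos0 mulr1.
move: xb; rewrite normrM gtr0_norm// mulrC ltr_pM2r//.
rewrite -intr_norm -[2]/(2%:~R) ltr_int.
case: n {xE} => [[|[|n]]|[|n]] //= _.
- by rewrite mulr0.
- rewrite expr1z => /eqP; rewrite -subr_eq0 -opprD oppr_eq0.
  by rewrite -[1 + 1]/(2%:R) pnatr_eq0.
- rewrite NegzE exprN1 invrN1 => /eqP; rewrite -subr_eq0 -opprD oppr_eq0.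
  by rewrite -[1 + 1]/(2%:R) pnatr_eq0.
Qed.

Lemma IVT_ratio f x y l : x <= y -> {within `[x, y], continuous f} ->
  0 <= l <= 1 -> exists2 t, x <= t <= y & f t = f x + l * (f y - f x).
Proof.
move=> xy cf /andP[l0 l1].
have [|c] := IVT (v := f x + l * (f y - f x)) xy cf; last first.
  by rewrite in_itv/= => ? ?; exists c.
rewrite /Num.min /Num.max; case: ltgtP => h; apply/andP; split; nra.
Qed.

(** Bounds the increment of an angle whose cosine keeps its sign: it cannot pass
    through the direction opposite to its initial one. *)
Lemma IVT_pi f x y : x <= y -> {within `[x, y], continuous f} ->
  pi <= `|f y - f x| ->
  exists2 t, x <= t <= y & `|f t - f x| = pi /\ cos (f t) = - cos (f x).
Proof.
move=> xy cf h; have pi0 := pi_gt0 R.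
have d0 : 0 < `|f y - f x| by apply: lt_le_trans h.
have [|t txy ft] := IVT_ratio (l := pi / `|f y - f x|) xy cf.
  by rewrite (divr_ge0 (ltW pi0) (ltW d0)) /= ler_pdivrMr// mul1r.
exists t => //; rewrite ft; move: d0 {h ft}.
move: (f y - f x) => d; rewrite normr_gt0 => d0.
rewrite addrAC subrr add0r !normrM normfV normr_id (gtr0_norm pi0).
rewrite mulfVK ?normr_eq0//; split=> //.
have [dp|dn|/eqP] := ltgtP 0 d; last by rewrite eq_sym (negbTE d0).
  by rewrite gtr0_norm// mulfVK// cosDpi.
rewrite ltr0_norm// invrN mulrN mulNr mulfVK//.
by rewrite -[in RHS](subrK pi (f x)) cosDpi opprK.
Qed.

Lemma increment_lt_pi f x y : x <= y -> {within `[x, y], continuous f} ->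
  (forall t, x <= t <= y -> cos (f t) > 0) -> `|f y - f x| < pi.
Proof.
move=> xy cf cosf; rewrite ltNge; apply/negP => /(IVT_pi xy cf)[t /cosf + [_ ct]].
have : cos (f x) > 0 by apply: cosf; rewrite lexx xy.
by rewrite ct; lra.
Qed.

(** An angle that starts and ends on the vertical axis and stays to the right of
    it in between makes half a turn if it ends on the other side of the origin,
    and none otherwise. It cannot leave an interval of length pi, so it moves by
    0 or by pi in absolute value; its value halfway, which points to the right,
    settles the sign. *)
Lemma increment_half_turn f x y : x <= y -> {within `[x, y], continuous f} ->
  (forall t, x < t < y -> cos (f t) > 0) -> cos (f x) = 0 -> cos (f y) = 0 ->
  f y - f x = pi / 2 * (sin (f y) - sin (f x)).
Proof.
move=> xy cf cosf cx cy; have pi0 := pi_gt0 R.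
have cosf0 t : x <= t <= y -> cos (f t) >= 0.
  move=> /andP[]; rewrite !le_eqVlt => /predU1P[<-|xt]; first by rewrite cx eqxx.
  by move=> /predU1P[->|ty]; [rewrite cy eqxx|rewrite cosf ?orbT// xt].
have dpi : `|f y - f x| <= pi.
  rewrite leNgt; apply/negP => h.
  have [t /andP[xt ty] [ft ct]] := IVT_pi xy cf (ltW h).
  have tx : t != x.
    by apply/eqP => tx; move: ft; rewrite tx subrr normr0; lra.
  have ty' : t != y.
    by apply/eqP => e; move: ft; rewrite e; lra.
  have : 0 < cos (f t) by apply: cosf; rewrite !lt_neqAle xt ty eq_sym tx ty'.
  by rewrite ct cx oppr0 ltxx.
have sq1 (z : R) : cos z = 0 -> sin z ^+ 2 = 1.
  by move=> c; rewrite sin2cos2 c expr0n subr0.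
have cosd : cos (f y - f x) = sin (f y) * sin (f x).
  by rewrite cosB cx cy mul0r add0r.
have [c cxy] := IVT_ratio (l := 2^-1) xy cf ltac:(by lra).
move=> fc; have := cosf0 c cxy; rewrite fc cosD cx mul0r sub0r.
have sgn (z : R) : cos z = 0 -> sin z = 1 \/ sin z = -1.
  by move=> /sq1/eqP; rewrite sqrf_eq1 => /orP[] /eqP; [left|right].
(* Two vertical directions: [d] is 0 if they are equal, pi or - pi if not. *)
move: (f y - f x) dpi cosd => d dpi cosd.
have eq_pi : cos d = -1 -> d = pi \/ d = - pi.
  move=> cd; have : pi - `|d| = 0.
    apply: cos_eq1; last by rewrite ger0_norm; have := normr_ge0 d; lra.
    by rewrite cosB cospi sinpi cos_norm cd mul0r addr0 mulrNN mulr1.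
  by case: ger0P => ? ?; [left|right]; lra.
have sin_half e : sin (2^-1 * (- e)) = - sin (e / 2) :> R.
  by rewrite mulrN sinN mulrC.
have [sx|sx] := sgn _ cx; have [sy|sy] := sgn _ cy; rewrite sx sy in cosd *.
- by move=> _; rewrite (cos_eq1 (x := d)) ?cosd ?mul1r//; lra.
- have [|->|->] := eq_pi; first by rewrite cosd mulN1r.
    by rewrite [2^-1 * _]mulrC sin_pihalf; lra.
  by move=> _; lra.
- have [|->|->] := eq_pi; first by rewrite cosd mul1r.
    by move=> _; lra.
  by rewrite sin_half sin_pihalf; lra.
- by move=> _; rewrite (cos_eq1 (x := d)) ?cosd ?mulrNN ?mul1r//; lra.
Qed.

(** The curve that stays to the left of the vertical axis, turned by pi, stays to
    the right of it; one sign covers both cases. *)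
Lemma increment_half_turn_sign f x y k : x <= y ->
  {within `[x, y], continuous f} ->
  (forall t, x < t < y -> (-1) ^+ k * cos (f t) > 0) ->
  cos (f x) = 0 -> cos (f y) = 0 ->
  f y - f x = (-1) ^+ k * (pi / 2 * (sin (f y) - sin (f x))).
Proof.
move=> xy cf cosf cx cy.
have cE (z : R) : cos (z + pi *+ k) = (-1) ^+ k * cos z.
  by rewrite (alternatingn (@cosDpi R)).
have sE (z : R) : sin (z + pi *+ k) = (-1) ^+ k * sin z.
  by rewrite (alternatingn (@sinDpi R)).
have := @increment_half_turn (fun t => f t + pi *+ k) x y xy.
rewrite !cE !sE cx cy mulr0 => /(_ _ _ erefl erefl) h.
have -> : f y - f x = f y + pi *+ k - (f x + pi *+ k).
  by rewrite opprD addrACA subrr addr0.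
rewrite h; first by ring.
- by move=> t; apply: cvgD; [exact: cf|exact: cvg_cst].
- by move=> t; rewrite cE; exact: cosf.
Qed.

Lemma polar_angle_cosB v theta theta' :
  polar_angle v theta -> polar_angle v theta' -> cos (theta' - theta) = 1.
Proof.
move=> [r r0 ->] [s s0 [h1 h2]]; rewrite cosB.
have := cos2Dsin2 theta; have := cos2Dsin2 theta'.
move: h1 h2; move: (cos _) (sin _) (cos _) (sin _) => a b c d h1 h2 h3 h4.
have rs : r = s.
  apply/eqP; rewrite -(eqrXn2 (ltn0Sn 1)) ?ltW//; apply/eqP.
  have : (r * c) ^+ 2 + (r * d) ^+ 2 = (s * a) ^+ 2 + (s * b) ^+ 2 by rewrite h1 h2.
  by rewrite !exprMn -!mulrDr h3 h4 !mulr1.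
subst s; have rn0 : r != 0 by rewrite gt_eqF.
by rewrite -(mulfI rn0 h1) -(mulfI rn0 h2) -!expr2.
Qed.

(** Numbers with cosine 1 are multiples of 2 pi, and a continuous function cannot
    move from one of them to another without taking intermediate values. *)
Lemma cos1_constant f x y : x <= y -> {within `[x, y], continuous f} ->
  (forall t, x <= t <= y -> cos (f t) = 1) -> f y = f x.
Proof.
move=> xy cf f1; apply/eqP; rewrite -subr_eq0; apply/eqP.
have f0 : sin (f x) = 0 by apply: cos1sin0; rewrite f1 ?lexx// normr1.
apply: cos_eq1; first by rewrite cosB f0 !f1 ?lexx ?xy// mulr0 addr0 mulr1.
have pi0 := pi_gt0 R.
have := @increment_lt_pi f x y xy cf.
by move=> /(_ _)/lt_trans; apply; [move=> t /f1 ->|lra].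
Qed.

Lemma polar_angle_increment (u : R -> R * R) f g x y : x <= y ->
  {within `[x, y], continuous f} -> {within `[x, y], continuous g} ->
  (forall t, x <= t <= y -> polar_angle (u t) (f t)) ->
  (forall t, x <= t <= y -> polar_angle (u t) (g t)) ->
  g y - g x = f y - f x.
Proof.
move=> xy cf cg uf ug.
suff : g y - f y = g x - f x by lra.
apply: (@cos1_constant (fun t => g t - f t)) => // [t|t xty].
  by apply: cvgB; [exact: cg|exact: cf].
exact: polar_angle_cosB (uf t xty) (ug t xty).
Qed.

Lemma turnsE (u : R -> R * R) (theta : R -> R) : continuous_arg u theta ->
  turns u = (theta 1 - theta 0) / (2 * pi).
Proof.
move=> [ct ut]; apply: xget_unique; first by exists theta.
move=> w [g [cg ug] ->]; congr (_ / _).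
exact: polar_angle_increment ler01 ct cg ut ug.
Qed.

Lemma polar_angle_exists v : v != 0 -> exists theta, polar_angle v theta.
Proof.
case: v => a b; have [r0|] := ltrP 0 (a ^+ 2 + b ^+ 2); last first.
  move=> h /negP[]; have a0 : a ^+ 2 = 0 by nra.
  have b0 : b ^+ 2 = 0 by nra.
  by move/eqP: a0; move/eqP: b0; rewrite !sqrf_eq0 => /eqP -> /eqP ->.
move=> _; pose r := Num.sqrt (a ^+ 2 + b ^+ 2).
have rp : 0 < r by rewrite sqrtr_gt0.
have rr : r ^+ 2 = a ^+ 2 + b ^+ 2 by rewrite sqr_sqrtr// ltW.
have ar : -1 <= a / r <= 1.
  by rewrite ler_pdivrMr// ler_pdivlMr//; apply/andP; split; nra.
have ac : r * cos (acos (a / r)) = a.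
  by rewrite acosK// mulrC divfK// gt_eqF.
have as' : (r * sin (acos (a / r))) ^+ 2 = b ^+ 2.
  rewrite exprMn sin2cos2 mulrBr -exprMn ac rr; ring.
move/eqP: as'; rewrite eqf_sqr => /orP[] /eqP as'.
  by exists (acos (a / r)), r; rewrite // ac as'.
by exists (- acos (a / r)), r; rewrite // cosN sinN mulrN ac as' opprK.
Qed.

End Angles.

(** * Lifting the polar angle along a homotopy *)

Definition unit_square {R : realType} : set (R * R) := `[0, 1] `*` `[0, 1].

Section Lifting.
Variable R : realType.
Implicit Types (a h x y t theta : R) (u v w : R * R) (f : R -> R).

Definition dot u v := u.1 * v.1 + u.2 * v.2.
Definition cross u v := u.1 * v.2 - u.2 * v.1.
(** The signed angle from [u] to [v], provided that the two vectors make an acute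
    angle. It then depends continuously on them, which makes it the elementary
    step from which continuous angles are built. *)
Definition angle_between u v := atan (cross u v / dot u v).

Lemma angle_betweenvv u : angle_between u u = 0.
Proof. by rewrite /angle_between /cross [u.1 * _]mulrC subrr mul0r atan0. Qed.

Lemma dotvv_gt0 u : u != 0 -> 0 < dot u u.
Proof.
case: u => a b; rewrite /dot /= -!expr2 => ab0.
rewrite lt_neqAle addr_ge0 ?sqr_ge0// andbT eq_sym paddr_eq0 ?sqr_ge0//.
by rewrite !sqrf_eq0; apply: contra ab0 => /andP[/eqP-> /eqP->].
Qed.

Lemma polar_angle_turn u v theta : polar_angle u theta -> 0 < dot u v ->
  polar_angle v (theta + angle_between u v).
Proof.
move=> [r r0 ->]; case: v => a b; set D := dot _ _ => D0.
pose t := atan (cross (r * cos theta, r * sin theta) (a, b) / D).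
have ct0 : 0 < cos t by rewrite cos_gt0_pihalf// atan_gtNpi2 atan_ltpi2.
have tt : sin t = cross (r * cos theta, r * sin theta) (a, b) / D * cos t.
  by rewrite -[X in X * _]atanK /tan divfK// gt_eqF.
exists (D / r / cos t); first by rewrite !divr_gt0.
rewrite /angle_between -/t cosD sinD tt.
have e1 : cos theta ^+ 2 = 1 - sin theta ^+ 2 by exact: cos2sin2.
congr (_, _); apply/eqP.
  rewrite -subr_eq0; apply/eqP.
  transitivity (a - (D * cos theta -
    cross (r * cos theta, r * sin theta) (a, b) * sin theta) / r).
    by rewrite /D /dot /cross /=; field: e1; rewrite !gt_eqF.
  by rewrite /D /dot /cross /=; field: e1; rewrite gt_eqF.
rewrite -subr_eq0; apply/eqP.
transitivity (b - (D * sin theta +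
  cross (r * cos theta, r * sin theta) (a, b) * cos theta) / r).
  by rewrite /D /dot /cross /=; field: e1; rewrite !gt_eqF.
by rewrite /D /dot /cross /=; field: e1; rewrite gt_eqF.
Qed.

Section continuity.
Variables (T : topologicalType) (x : T).

Lemma continuous_fst_snd (f : T -> R * R) : {for x, continuous f} ->
  {for x, continuous (fun z => (f z).1)} /\ {for x, continuous (fun z => (f z).2)}.
Proof.
move=> cf; split.
  by apply: (cvg_comp _ _ cf); exact: cvg_fst.
by apply: (cvg_comp _ _ cf); exact: cvg_snd.
Qed.

Lemma continuous_dot (f g : T -> R * R) :
  {for x, continuous f} -> {for x, continuous g} ->
  {for x, continuous (fun z => dot (f z) (g z))}.
Proof.
move=> /continuous_fst_snd[f1 f2] /continuous_fst_snd[g1 g2].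
by apply: cvgD; apply: cvgM.
Qed.

Lemma continuous_angle_between (f g : T -> R * R) :
  {for x, continuous f} -> {for x, continuous g} -> 0 < dot (f x) (g x) ->
  {for x, continuous (fun z => angle_between (f z) (g z))}.
Proof.
move=> cf cg d0; apply: continuous_comp; last exact: continuous_atan.
have [f1 f2] := continuous_fst_snd cf; have [g1 g2] := continuous_fst_snd cg.
apply: cvgM; first by apply: cvgB; apply: cvgM.
by apply: cvgV; [rewrite gt_eqF|exact: continuous_dot].
Qed.

Lemma continuous_sum n (f : 'I_n -> T -> R) :
  (forall k, {for x, continuous (f k)}) ->
  {for x, continuous (fun z => \sum_(k < n) f k z)}.
Proof.
move=> cf; apply: cvg_big => [|k _]; [exact: add_continuous|exact: cf].
Qed.

Lemma continuous_pair (f g : T -> R) :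
  {for x, continuous f} -> {for x, continuous g} ->
  {for x, continuous (fun z => (f z, g z))}.
Proof. by move=> cf cg; exact: (cvg_pair cf cg). Qed.
End continuity.

Definition clamp t : R := Num.max 0 (Num.min t 1).

Lemma clamp_itv t : 0 <= clamp t <= 1.
Proof. by rewrite /clamp le_max lexx /= ge_max ler01 ge_min lexx orbT. Qed.

Lemma clampK t : 0 <= t <= 1 -> clamp t = t.
Proof. by move=> /andP[t0 t1]; rewrite /clamp min_l// max_r. Qed.

Lemma continuous_clamp : continuous clamp.
Proof.
move=> x; apply: (@continuous_max R _ (cst 0) (fun t => Num.min t 1));
  first exact: cvg_cst.
by apply: (@continuous_min R _ id (cst 1)); [exact: cvg_id|exact: cvg_cst].
Qed.

Lemma within_comp (T U V : topologicalType) (A : set T) (B : set U)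
  (f : T -> U) (g : U -> V) : continuous f -> (forall z, A z -> B (f z)) ->
  {within B, continuous g} -> {within A, continuous (g \o f)}.
Proof.
move=> cf fAB /subspace_continuousP cg; apply/subspace_continuousP => z Az.
apply: cvg_comp (cg _ (fAB z Az)) => C /cf h.
by apply: (@filterS _ (nbhs z) _ _ _ _ h) => w /= {}h /fAB.
Qed.

Lemma continuous_comp_within (T U V : topologicalType) (B : set U)
  (f : T -> U) (g : U -> V) : continuous f -> (forall z, B (f z)) ->
  {within B, continuous g} -> continuous (g \o f).
Proof.
move=> cf fB cg; apply/continuous_subspace_setT.
by apply: within_comp cg => // z _; exact: fB.
Qed.

Lemma unit_squareP a t : unit_square (a, t) <-> 0 <= a <= 1 /\ 0 <= t <= 1.
Proof. by split; rewrite /unit_square /setX /= !in_itv. Qed.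

(** At [h = 0] the scalar product is a squared norm, hence positive; it remains
    positive for small [h], uniformly so on a compact square. *)
Lemma uniformly_acute (G : R * R -> R * R) : continuous G ->
  (forall z, G z != 0) ->
  exists n : nat, forall a t h, 0 <= a <= 1 -> 0 <= t <= 1 ->
    `|h| <= n.+1%:R^-1 -> 0 < dot (G (a, t)) (G (a + h, t)).
Proof.
move=> cG G0.
have cs : compact (@unit_square R) by apply: compact_setX; exact: segment_compact.
move/compact_near_coveringP : cs.
move=> /(_ R (nbhs (0 : R)) (fun h z => 0 < dot (G z) (G (z.1 + h, z.2)))
  (nbhs_filter _))[].
  move=> z _; pose K (w : (R * R) * R) := dot (G w.1) (G (w.1.1 + w.2, w.1.2)).
  have cK : {for (z, 0), continuous K}.
    apply: continuous_dot.
      by apply: (cvg_comp (@fst _ _) G); [exact: cvg_fst|exact: cG].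
    apply: (continuous_comp (f := fun w : (R * R) * R => (w.1.1 + w.2, w.1.2)));
      last exact: cG.
    apply: continuous_pair.
      apply: cvgD; last exact: cvg_snd.
      by apply: (cvg_comp (@fst _ _) (@fst _ _)); exact: cvg_fst.
    by apply: (cvg_comp (@fst _ _) (@snd _ _)); [exact: cvg_fst|exact: cvg_snd].
  have : K (z, 0) > 0.
    by rewrite /K /= addr0 -surjective_pairing; exact: dotvv_gt0.
  by move=> /(cvgr_gt _ cK).
move=> e /= e0 eP.
exists (Num.bound e^-1) => a t h a01 t01 hn.
apply: (eP h _ (a, t)); last exact/unit_squareP.
rewrite /= sub0r normrN; apply: le_lt_trans hn _.
rewrite invf_plt ?posrE//.
by rewrite (lt_trans (archi_boundP _))// ?ltr_nat// invr_ge0 (ltW e0).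
Qed.

(** Homotopy lifting for the polar angle. The column [a] is reached from the
    column 0 by [n.+1] steps, so short that every step turns every vector by an
    acute angle; adding these angles to [theta0] gives an angle for [H a] that
    varies continuously with [a] as well as with [t]. *)
Lemma lifting (H : R -> R -> R * R) (theta0 : R -> R) :
  {within unit_square, continuous (fun z => H z.1 z.2)} ->
  (forall a t, 0 <= a <= 1 -> 0 <= t <= 1 -> H a t != 0) ->
  continuous_arg (H 0) theta0 ->
  exists Theta : R -> R -> R,
    [/\ forall t, Theta 0 t = theta0 t,
        forall a, 0 <= a <= 1 -> continuous_arg (H a) (Theta a) &
        forall t, 0 <= t <= 1 -> {within `[0, 1], continuous (Theta ^~ t)}].
Proof.
move=> cH H0 [ct pt].
(* Clamping both parameters extends [H] to a continuous map on the plane. *)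
pose G (z : R * R) := H (clamp z.1) (clamp z.2).
have GE a t : 0 <= a <= 1 -> 0 <= t <= 1 -> G (a, t) = H a t.
  by move=> a01 t01; rewrite /G /= !clampK.
have cG : continuous G.
  apply: (@continuous_comp_within _ _ _ unit_square
    (fun z : R * R => (clamp z.1, clamp z.2)) (fun z => H z.1 z.2)) => // [z|z].
    apply: (@continuous_pair _ z (fun z : R * R => clamp z.1)
      (fun z => clamp z.2)); apply: continuous_comp;
      [exact: cvg_fst|exact: continuous_clamp
      |exact: cvg_snd|exact: continuous_clamp].
  by apply/unit_squareP; rewrite !clamp_itv.
have [|n nP] := uniformly_acute cG.
  by move=> z; apply: H0; exact: clamp_itv.
pose s (k : nat) (a : R) := k%:R * (a / n.+1%:R).
have sS k a : s k.+1 a = s k a + a / n.+1%:R.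
  by rewrite /s -natr1 mulrDl mul1r.
have sn a : s n.+1 a = a by rewrite /s mulrC divfK// pnatr_eq0.
have s01 k a : (k <= n.+1)%N -> 0 <= a <= 1 -> 0 <= s k a <= 1.
  move=> kn /andP[a0 a1]; rewrite mulr_ge0 ?divr_ge0//= -(sn 1) /s mul1r.
  by rewrite ler_pM ?divr_ge0 ?ler_nat// ler_pdivrMr// mulVf// pnatr_eq0.
have acute k a t : (k < n.+1)%N -> 0 <= a <= 1 -> 0 <= t <= 1 ->
    0 < dot (G (s k a, t)) (G (s k.+1 a, t)).
  move=> kn a01 t01; rewrite sS; apply: nP; rewrite ?s01// 1?ltnW//.
  move/andP: a01 => [a0 a1]; rewrite ger0_norm ?divr_ge0// ler_pdivrMr//.
  by rewrite mulVf// pnatr_eq0.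
pose ang k (a t : R) := angle_between (G (s k a, t)) (G (s k.+1 a, t)).
have cG1 k t : continuous (fun a => G (s k a, t)).
  move=> a; apply: continuous_comp; last exact: cG.
  apply: continuous_pair; last exact: cvg_cst.
  by apply: cvgMl_tmp; apply: cvgMr_tmp; exact: cvg_id.
have cG2 k a : continuous (fun t => G (s k a, t)).
  move=> t; apply: continuous_comp; last exact: cG.
  by apply: continuous_pair; [exact: cvg_cst|exact: cvg_id].
exists (fun a t => theta0 t + \sum_(k < n.+1) ang k a t); split.
- move=> t; rewrite big1 ?addr0// => k _.
  by rewrite /ang /s !mul0r !mulr0 angle_betweenvv.
- move=> a a01; split.
    have cs : {within `[0, 1], continuous (fun t => \sum_(k < n.+1) ang k a t)}.
      apply: continuous_in_subspaceT => t; rewrite inE /= in_itv/= => t01.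
      apply: continuous_sum => k.
      by apply: continuous_angle_between; [exact: cG2|exact: cG2|exact: acute].
    by move=> t; apply: cvgD; [exact: ct|exact: cs].
  move=> t t01.
  suff h m : (m <= n.+1)%N ->
      polar_angle (G (s m a, t)) (theta0 t + \sum_(k < m) ang k a t).
    by have := h n.+1 (leqnn _); rewrite sn GE.
  elim: m => [_|m IH mn].
    rewrite big_ord0 addr0 /s mul0r GE ?lexx ?ler01//; exact: pt.
  rewrite big_ord_recr /= addrA; apply: polar_angle_turn; last exact: acute.
  by apply: IH; exact: ltnW.
- move=> t t01; apply: continuous_in_subspaceT => a.
  rewrite inE /= in_itv/= => a01.
  apply: cvgD; first exact: cvg_cst.
  apply: continuous_sum => k.
  by apply: continuous_angle_between; [exact: cG1|exact: cG1|exact: acute].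
Qed.

End Lifting.

(** * Homotopy invariance of winding numbers *)

Section Homotopy.
Variable R : realType.
Implicit Types (a x y t : R) (v w : R * R).

(** The contraction [u (a * t)] joins a constant curve, which has a constant angle,
    to [u]; the angle is lifted along it. Clamping extends [u] continuously to
    the whole line. *)
Lemma continuous_arg_exists (u : R -> R * R) :
  {within `[0, 1], continuous u} -> (forall t, 0 <= t <= 1 -> u t != 0) ->
  exists theta, continuous_arg u theta.
Proof.
move=> cu u0; have z01 : (0 : R) <= 0 <= (1 : R) by rewrite lexx ler01.
have [theta0 utheta0] := polar_angle_exists (u0 0 z01).
have cv : continuous (u \o @clamp R).
  apply: continuous_comp_within cu; first exact: continuous_clamp.
  by move=> t; rewrite /= in_itv/= clamp_itv.
pose H a t := u (clamp (a * t)).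
have clamp0 : clamp 0 = 0 :> R by rewrite clampK ?lexx ?ler01.
have [||| Theta [_ + _]] := @lifting R H (fun=> theta0).
- apply: continuous_subspaceT => z.
  apply: (@continuous_comp _ _ _ (fun z : R * R => z.1 * z.2) (u \o @clamp R)).
    by apply: cvgM; [exact: cvg_fst|exact: cvg_snd].
  exact: cv.
- by move=> a t _ _; apply: u0; exact: clamp_itv.
- split; first by apply: continuous_subspaceT => t; exact: cvg_cst.
  by move=> t _; rewrite /H mul0r clamp0.
move=> /(_ 1); rewrite lexx ler01 => /(_ isT)[cT pT].
exists (Theta 1); split => //.
by move=> t t01; have := pT t t01; rewrite /H mul1r clampK.
Qed.

Lemma eq_turns (u v : R -> R * R) : {within `[0, 1], continuous u} ->
  (forall t, 0 <= t <= 1 -> u t != 0) -> (forall t, 0 <= t <= 1 -> u t = v t) ->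
  turns u = turns v.
Proof.
move=> cu u0 uv; have [theta ut] := continuous_arg_exists cu u0.
rewrite (turnsE ut) (turnsE (theta := theta))//; case: ut => ct ut; split=> //.
by move=> t t01; rewrite -uv//; exact: ut.
Qed.

Lemma polar_angle_rotation v (theta phi : R) : polar_angle v theta ->
  polar_angle (rotation phi v) (theta + phi).
Proof.
move=> [r r0 ->]; exists r => //; rewrite /rotation /= cosD sinD.
by congr (_, _); ring.
Qed.

Lemma rotation0 v : rotation 0 v = v.
Proof.
by case: v => a b; rewrite /rotation cos0 sin0 !mul1r !mul0r subr0 add0r.
Qed.

Lemma rotationB phi v w : rotation phi (v - w) = rotation phi v - rotation phi w.
Proof. by rewrite /rotation; congr (_, _) => /=; ring. Qed.

Lemma continuous_slice (H : R -> R -> R * R) a :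
  {within unit_square, continuous (fun z : R * R => H z.1 z.2)} ->
  0 <= a <= 1 -> {within `[0, 1], continuous (H a)}.
Proof.
move=> cH a01; apply: (within_comp (f := fun t => (a, t)) _ _ cH) => [t|t /=].
  by apply: (@continuous_pair R R t (cst a) id); [exact: cvg_cst|exact: cvg_id].
by rewrite in_itv /= => t01; exact/unit_squareP.
Qed.

(** Along the homotopy, both [Theta a 1 + phi a] and [Theta a 0] are polar angles
    of [H a 0], so that their difference is a multiple of 2 pi. As it varies
    continuously with [a], it is constant. *)
Lemma turns_homotopy (H : R -> R -> R * R) (phi : R -> R) :
  {within unit_square, continuous (fun z : R * R => H z.1 z.2)} ->
  (forall a t, 0 <= a <= 1 -> 0 <= t <= 1 -> H a t != 0) ->
  {within `[0, 1], continuous phi} ->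
  (forall a, 0 <= a <= 1 -> H a 0 = rotation (phi a) (H a 1)) ->
  turns (H 0) + phi 0 / (2 * pi) = turns (H 1) + phi 1 / (2 * pi).
Proof.
move=> cH H0 cphi Hphi.
have z01 : (0 : R) <= 0 <= (1 : R) by rewrite lexx ler01.
have o01 : (0 : R) <= 1 <= (1 : R) by rewrite lexx ler01.
have cH0 := continuous_slice cH z01.
have [theta0 arg0] := continuous_arg_exists cH0 (fun t => H0 0 t z01).
have [ Theta [_ argT cT]] := lifting cH H0 arg0.
rewrite (turnsE (argT 0 z01)) (turnsE (argT 1 o01)) -!mulrDl; congr (_ / _).
apply/esym; apply: (@cos1_constant R (fun a => Theta a 1 - Theta a 0 + phi a)) => //.
  by move=> a; apply: cvgD; [apply: cvgB; exact: cT|exact: cphi].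
move=> a a01; rewrite addrAC.
have [_ pa] := argT a a01.
apply: (polar_angle_cosB (pa 0 z01)); rewrite Hphi//.
by apply: polar_angle_rotation; exact: pa.
Qed.

Lemma turns_cst v : v != 0 -> turns (fun=> v) = 0.
Proof.
move=> /polar_angle_exists[theta vt].
rewrite (turnsE (theta := fun=> theta)) ?subrr ?mul0r//; split=> // t.
exact: cvg_cst.
Qed.

Section configurations.
Variables (N : nat) (M : R -> 'I_N -> R * R).

(** The constant formation has winding numbers 0, so a weak homotopy to it makes
    all winding numbers of [M] equal to the number of turns of the rotation. *)
Lemma winding_number_homotopy (H : R -> R -> 'I_N -> R * R) (phi : R -> R) i j :
  collision_free_family M (fun=> M 0) H -> {within `[0, 1], continuous phi} ->
  (forall a, 0 <= a <= 1 -> forall i, H a 0 i = rotation (phi a) (H a 1 i)) ->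
  i != j -> winding_number M i j = (phi 1 - phi 0) / (2 * pi).
Proof.
move=> [cH iH H0 H1] cphi Hphi ij; pose D a t := H a t j - H a t i.
have z01 : (0 : R) <= 0 <= (1 : R) by rewrite lexx ler01.
have o01 : (0 : R) <= 1 <= (1 : R) by rewrite lexx ler01.
have D0 a t : 0 <= a <= 1 -> 0 <= t <= 1 -> D a t != 0.
  move=> a01 t01; rewrite subr_eq0; apply: contra ij => /eqP/(iH _ _ a01 t01) ->.
  exact: eqxx.
have cD : {within unit_square, continuous (fun z : R * R => D z.1 z.2)}.
  by move=> z; apply: cvgB; exact: cH.
have Dphi a : 0 <= a <= 1 -> D a 0 = rotation (phi a) (D a 1).
  by move=> a01; rewrite /D rotationB !Hphi.
have := turns_homotopy cD D0 cphi Dphi.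
rewrite (eq_turns (v := fun t => M t j - M t i)); first last.
- by move=> t t01; rewrite /D !H0.
- by move=> t; exact: D0.
- exact: continuous_slice.
rewrite (eq_turns (u := D 1) (v := fun t => M 0 j - M 0 i)); first last.
- by move=> t t01; rewrite /D !H1.
- by move=> t; exact: D0.
- exact: continuous_slice.
rewrite turns_cst; first by rewrite /winding_number; lra.
by rewrite -!(H1 0 z01); exact: D0.
Qed.

End configurations.

Lemma not_weakly_homotopic N (M : R -> 'I_N -> R * R) (i j i' j' : 'I_N) :
  i != j -> i' != j' -> winding_number M i j != winding_number M i' j' ->
  strongly_entangled M.
Proof.
move=> ij ij' w [H [phi [cH cphi Hphi]]]; move/eqP: w; apply.
by rewrite !(winding_number_homotopy cH cphi Hphi).
Qed.

(** A strong homotopy is a weak one whose rotation angle is constantly 0. *)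
Lemma not_strongly_homotopic N (M : R -> 'I_N -> R * R) (i j : 'I_N) :
  i != j -> winding_number M i j != 0 -> weakly_entangled M.
Proof.
move=> ij w [H [cH H01]]; move/eqP: w; apply.
rewrite (@winding_number_homotopy _ _ H (fun=> 0)) ?subrr ?mul0r// => [t|a a01 k].
  exact: cvg_cst.
by rewrite rotation0 H01.
Qed.

End Homotopy.

(** * Turns of Lissajous curves *)

Section Lissajous.
Variable R : realType.
Implicit Types (a b d x y t A B : R) (v w : R * R).

(** The reflection [theta |-> c - theta] carries the first half of the curve to the
    second and reverses the sense of rotation, so the second half undoes the turns
    of the first. *)
Lemma turns_reflection (u : R -> R * R) c : continuous u ->
  (forall t, u t != 0) ->
  (forall t theta, polar_angle (u t) theta ->
    polar_angle (u (t + 2^-1)) (c - theta)) ->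
  turns u = 0.
Proof.
move=> cu u0 uc.
have [theta arg] :=
  continuous_arg_exists (continuous_subspaceT cu) (fun t _ => u0 t).
rewrite (turnsE arg); case: arg => ct ut.
have half01 t : 0 <= t <= 2^-1 -> (0 <= t <= 1) && (0 <= t + 2^-1 <= 1) by lra.
have cA : {within `[0, 2^-1], continuous (fun t => c - theta t)}.
  move=> t; apply: cvgB; first exact: cvg_cst.
  apply: (continuous_subspaceW _ ct) => x /=.
  by rewrite !in_itv /= => /half01/andP[].
have cB : {within `[0, 2^-1], continuous (fun t => theta (t + 2^-1))}.
  apply: (within_comp (f := fun t => t + 2^-1) _ _ ct) => [t|t /=].
    by apply: cvgD; [exact: cvg_id|exact: cvg_cst].
  by rewrite !in_itv /= => /half01/andP[].
have := @polar_angle_increment R (fun t => u (t + 2^-1)) _ _ 0 2^-1 _ cA cB.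
have -> : 2^-1 + 2^-1 = 1 :> R by lra.
rewrite add0r => e; suff -> : theta 1 - theta 0 = 0 by rewrite mul0r.
suff : theta 1 - theta 2^-1 = c - theta 2^-1 - (c - theta 0) by lra.
apply: e => [|t /half01/andP[t01 _]|t /half01/andP[_ t01]]; first by lra.
  by apply: uc; exact: ut.
exact: ut.
Qed.

(** Moving the starting point of a closed curve continuously is a homotopy through
    closed curves. *)
Lemma turns_shift (u : R -> R * R) t0 : continuous u ->
  (forall t, u t != 0) -> (forall t, u (t + 1) = u t) ->
  turns (fun t => u (t0 + t)) = turns u.
Proof.
move=> cu u0 up; pose H a t := u (a * t0 + t).
have cH : continuous (fun z : R * R => H z.1 z.2).
  move=> z; apply: (@continuous_comp _ _ _ (fun z : R * R => z.1 * t0 + z.2) u).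
    apply: cvgD; last exact: cvg_snd.
    by apply: cvgMr_tmp; exact: cvg_fst.
  exact: cu.
have := @turns_homotopy R H (cst 0) (continuous_subspaceT cH)
  (fun _ _ _ _ => u0 _).
rewrite mul0r !addr0 /H mul1r.
have -> : (fun t => u (0 * t0 + t)) = u by apply/funext => t; rewrite mul0r add0r.
move=> e; apply/esym; apply: e => [t|a _]; first exact: cvg_cst.
by rewrite rotation0 addr0 up.
Qed.

Lemma sum_signs n : \sum_(m < n) (-1) ^+ m = (odd n)%:R :> R.
Proof.
elim: n => [|n IH]; first by rewrite big_ord0.
rewrite big_ord_recr /= IH -signr_odd.
by case: (odd n); rewrite /= ?expr1 ?subrr ?add0r.
Qed.

(** Multiplication by [q] permutes the residues modulo [p], so this is the
    alternating sum of [p] signs, and [p] is odd. *)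
Lemma sum_signs_mulr p q : odd p -> coprime p q ->
  \sum_(k < p) (-1) ^+ ((q * k) %% p) = 1 :> R.
Proof.
move=> op cpq; have p0 : (0 < p)%N by case: p op {cpq}.
pose h (k : 'I_p) := Ordinal (ltn_pmod (q * k) p0).
have hi : injective h.
  move=> k l /(congr1 val) /= /eqP; wlog kl : k l / (k <= l)%N => [W|].
    by case: (leqP k l) => [/W//|/ltnW/W W1]; rewrite eq_sym => /W1 ->.
  rewrite eq_sym eqn_mod_dvd ?leq_mul// -mulnBr Gauss_dvdr//.
  move=> /dvdnP[[|j]].
    move=> /eqP; rewrite subn_eq0 => lk.
    by apply/val_inj/eqP; rewrite eqn_leq kl.
  move=> e; have : (l - k < p)%N by rewrite (leq_ltn_trans (leq_subr _ _)).
  by rewrite e mulSn ltnNge leq_addr.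
transitivity ((odd p)%:R : R); last by rewrite op.
by rewrite -sum_signs [RHS](reindex_inj hi).
Qed.

Lemma sum_signs_mulr_double p q : odd p -> coprime p q ->
  \sum_(k < p + p) (-1) ^+ ((q * k) %% p) = 2 :> R.
Proof.
move=> op cpq; rewrite big_split_ord /= sum_signs_mulr//.
under eq_bigr do rewrite mulnDr modnMDl.
by rewrite sum_signs_mulr.
Qed.

Definition lissajous A B (p q : nat) a b t : R * R :=
  (A * sin (2 * pi * p%:R * t + a), B * sin (2 * pi * q%:R * t + b)).

Lemma continuous_lissajous A B p q a b : continuous (lissajous A B p q a b).
Proof.
have cs C r c : continuous (fun t => C * sin (2 * pi * r * t + c) : R).
  move=> t; apply: cvgMl_tmp; apply: continuous_comp; last exact: continuous_sin.
  by apply: cvgD; [apply: cvgMl_tmp; exact: cvg_id|exact: cvg_cst].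
move=> t.
apply: (@continuous_pair R R t (fun t => A * sin _) (fun t => B * sin _));
  exact: cs.
Qed.

Lemma lissajous_periodic A B p q a b t :
  lissajous A B p q a b (t + 1) = lissajous A B p q a b t.
Proof.
have e (r : nat) c :
    sin (2 * pi * r%:R * (t + 1) + c) = sin (2 * pi * r%:R * t + c).
  rewrite -[RHS](periodicn (@sinD2pi R) r); congr (sin _).
  by rewrite -mulr_natr -[pi *+ 2]mulr_natr; ring.
by rewrite /lissajous !e.
Qed.

Lemma sin_half_period (r : nat) c t :
  sin (2 * pi * r%:R * (t + 2^-1) + c) = (-1) ^+ r * sin (2 * pi * r%:R * t + c).
Proof.
by rewrite -(alternatingn (@sinDpi R)) -mulr_natr; congr (sin _); field.
Qed.

Lemma sign_sin_lt (k : nat) x : pi * k%:R < x < pi * k.+1%:R ->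
  0 < (-1) ^+ k * sin x.
Proof.
move=> kx; rewrite -(subrK (pi * k%:R) x) mulr_natr (alternatingn (@sinDpi R)).
rewrite mulrA -exprMn mulrNN mulr1 expr1n mul1r -mulr_natr.
apply: sin_gt0_pi; move: kx; rewrite -natr1; lra.
Qed.

Lemma sg_sin (k : nat) x : pi * k%:R < x < pi * k.+1%:R ->
  Num.sg (sin x) = (-1) ^+ k.
Proof.
move=> /sign_sin_lt/gtr0_sg; rewrite sgrM sgrX sgrN1 => h.
by rewrite -[RHS]mulr1 -[X in _ = _ * X]h mulrA -exprMn mulrNN mulr1 expr1n mul1r.
Qed.

Lemma polar_angle_sg v theta : polar_angle v theta ->
  Num.sg v.1 = Num.sg (cos theta) /\ Num.sg v.2 = Num.sg (sin theta).
Proof. by move=> [r r0 ->] /=; rewrite !sgrM gtr0_sg// !mul1r. Qed.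

Lemma sin_sg1 x : cos x = 0 -> sin x = Num.sg (sin x).
Proof.
move=> c0; have : sin x ^+ 2 == 1 by rewrite sin2cos2 c0 expr0n subr0.
by rewrite sqrf_eq1 => /orP[]/eqP ->; rewrite ?sgr1 ?sgrN1.
Qed.

Lemma sgr_exp A : A != 0 -> exists e : nat, Num.sg A = (-1) ^+ e.
Proof.
by move=> A0; exists (A < 0); rewrite sgr_def A0 mulr1n.
Qed.

(** The first coordinate vanishes at the times k / 2p only, so the increment of the
    angle between two consecutive such times is determined by the signs of the
    second coordinate there. At time k / 2p its phase is qk/p * pi + d, and
    [d < pi / p] keeps this strictly between two consecutive multiples of pi; so
    the second coordinate has the sign of [B], reversed if the quotient of qk by p
    is odd. As p and q are odd, k has the parity of the sum of this quotient and
    the remainder, and the alternating sum of the signs becomes a sum of signs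
    that depend on the remainders only. *)
Lemma turns_lissajous_in_phase A B (p q : nat) d : odd p -> odd q -> coprime p q ->
  A != 0 -> B != 0 -> 0 < d < pi / p%:R ->
  (forall t, lissajous A B p q 0 d t != 0) ->
  turns (lissajous A B p q 0 d) = - (Num.sg A * Num.sg B).
Proof.
move=> op oq cpq A0 B0 dp u0; set u := lissajous _ _ _ _ _ _ in u0 *.
have p0 : (0 < p)%N by case: p op {cpq dp u u0}.
have p0R : 0 < p%:R :> R by rewrite ltr0n.
have pi0 := pi_gt0 R.
have cu : continuous u by exact: continuous_lissajous.
have [theta arg] :=
  continuous_arg_exists (continuous_subspaceT cu) (fun t _ => u0 t).
rewrite (turnsE arg); case: arg => ct ut.
(* The zeros of the first coordinate. *)
pose s (k : nat) : R := k%:R / (2 * p%:R).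
have sE k : 2 * pi * p%:R * s k = pi * k%:R.
  by rewrite /s; field; rewrite gt_eqF.
have sS k : s k <= s k.+1.
  by rewrite ler_pM2r ?ler_nat// invr_gt0 mulr_gt0.
have s0 : s 0%N = 0 by rewrite /s mul0r.
have s1 : s (p + p)%N = 1 by rewrite /s natrD; field; rewrite gt_eqF.
have smono k l : (k <= l)%N -> s k <= s l.
  by move=> kl; rewrite ler_pM2r ?ler_nat// invr_gt0 mulr_gt0.
have s01 k t : (k < p + p)%N -> s k <= t <= s k.+1 -> 0 <= t <= 1.
  move=> kp /andP[h1 h2].
  by rewrite -s0 -s1 (le_trans _ h1) ?(le_trans h2)//; exact: smono.
have [e sgA] := sgr_exp A0.
pose g k : R := (-1) ^+ ((q * k) %% p).
pose sig k : R := Num.sg B * (-1) ^+ k * g k.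
have cos_s k : (k <= p + p)%N -> cos (theta (s k)) = 0.
  move=> kp; have [|r r0 [h _]] := ut (s k).
    by rewrite -s0 -s1 !smono.
  move: h; rewrite addr0 sE mulr_natr -[X in sin X]add0r (alternatingn (@sinDpi R)).
  by rewrite sin0 !mulr0 => /esym/eqP; rewrite mulf_eq0 gt_eqF//= => /eqP.
have sin_s k : (k <= p + p)%N -> sin (theta (s k)) = sig k.
  move=> kp; rewrite (sin_sg1 (cos_s k kp)).
  have [|_ <-] := polar_angle_sg (ut (s k) _); first by rewrite -s0 -s1 !smono.
  rewrite /u /lissajous /= sgrM (@sg_sin ((q * k) %/ p)).
    rewrite /sig /g -!mulrA -exprD -[in LHS]signr_odd -[in RHS]signr_odd.
    congr (_ * (-1) ^+ nat_of_bool _).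
    move: (divn_eq (q * k) p) => /(congr1 odd).
    by rewrite oddM oddD oddM op oq andbT /= oddD => ->; rewrite addbK.
  have -> : 2 * pi * q%:R * s k + d =
      pi * (q * k %/ p)%:R + (pi / p%:R * (q * k %% p)%:R + d).
    have := divn_eq (q * k) p => /(congr1 (fun n => n%:R : R)).
    rewrite natrD !natrM => e'; rewrite /s addrA; congr (_ + _).
    rewrite (_ : 2 * pi * _ * _ = pi / p%:R * (q%:R * k%:R)); last first.
      by field; rewrite gt_eqF.
    by rewrite e'; field; rewrite gt_eqF.
  have h0 : 0 < pi / p%:R :> R by rewrite divr_gt0.
  have hp : pi / p%:R * p%:R = pi :> R by rewrite divfK// gt_eqF.
  have : pi / p%:R * (q * k %% p)%:R + pi / p%:R <= pi :> R.
    have -> : pi / p%:R * (q * k %% p)%:R + pi / p%:R =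
        pi / p%:R * (q * k %% p).+1%:R :> R.
      by rewrite -natr1 mulrDr mulr1.
    by rewrite -[leRHS]hp ler_pM2l// ler_nat ltn_pmod.
  have : 0 <= pi / p%:R * (q * k %% p)%:R :> R by rewrite mulr_ge0// ltW.
  by move: dp; rewrite -natr1; lra.
have incr k : (k < p + p)%N -> theta (s k.+1) - theta (s k) =
    - (Num.sg A * Num.sg B * (pi / 2)) * (g k.+1 + g k).
  move=> kp.
  rewrite (@increment_half_turn_sign R theta (s k) (s k.+1) (k + e))
    ?cos_s ?sin_s ?(ltnW kp)//.
  - by rewrite /sig exprD -sgA exprS; ring: (sqrr_sign R k).
  - apply: (continuous_subspaceW _ ct) => x /=; rewrite !in_itv /=; exact: s01.
  - move=> t kt; rewrite -sgr_gt0.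
    have [|] := polar_angle_sg (ut t _); first by apply: (s01 k) => //; lra.
    rewrite /u /lissajous /= addr0 sgrM sgA => h _.
    rewrite sgrM sgrX sgrN1 exprD -h.
    rewrite (@sg_sin k); last first.
      move: kt => /andP[kt tk]; rewrite -!sE !ltr_pM2l ?kt ?tk//.
        by rewrite !mulr_gt0.
      by rewrite !mulr_gt0.
    rewrite [ltRHS](_ : _ = ((-1) ^+ k) ^+ 2 * ((-1) ^+ e) ^+ 2); last by ring.
    by rewrite !sqrr_sign mulr1 ltr01.
have -> : theta 1 - theta 0 =
    \sum_(k < p + p) (theta (s k.+1) - theta (s k)).
  transitivity ((theta \o s) (p + p)%N - (theta \o s) 0%N).
    by rewrite /= s0 s1.
  by rewrite -telescope_sumr// big_mkord.
under eq_bigr => k _ do rewrite (incr _ (ltn_ord k)).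
rewrite -mulr_sumr big_split /=.
have g0 : g 0%N = g (p + p)%N by rewrite /g muln0 mod0n mulnDr -mulnDl modnMl.
(* [g] has period p, so shifting the index by 1 does not change the sum. *)
have -> : \sum_(k < p + p) g k.+1 = \sum_(k < p + p) g k.
  apply: (addrI (g 0%N)); rewrite {2}g0 [RHS]addrC.
  by rewrite -(big_ord_recl _ (fun k : 'I_(p + p).+1 => g k)) big_ord_recr.
rewrite /g sum_signs_mulr_double//.
have cancel_pi (x y : R) : x != 0 -> - (y * (x / 2)) * (2 + 2) / (2 * x) = - y.
  by move=> x0; field.
by rewrite cancel_pi// gt_eqF.
Qed.

(** If one coordinate vanished identically, then the curve would meet the origin at
    any zero of the other one. *)
Lemma lissajous_amplitude_neq0 A B (p q : nat) a b : (0 < p)%N -> (0 < q)%N ->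
  (forall t, lissajous A B p q a b t != 0) -> A != 0 /\ B != 0.
Proof.
move=> p0 q0 u0.
have z (r : nat) c : (0 < r)%N ->
    2 * pi * r%:R * (- c / (2 * pi * r%:R)) + c = 0 :> R.
  move=> r0; have d0 : 2 * pi * r%:R != 0 :> R.
    by rewrite gt_eqF// !mulr_gt0 ?pi_gt0 ?ltr0n.
  by rewrite mulrC divfK// addNr.
split; apply/eqP => h.
  have /negP[] := u0 (- b / (2 * pi * q%:R)).
  by rewrite /lissajous h mul0r z// sin0 mulr0.
have /negP[] := u0 (- a / (2 * pi * p%:R)).
by rewrite /lissajous h mul0r z// sin0 mulr0.
Qed.

Lemma polar_angle_reflect_x v theta : polar_angle v theta ->
  polar_angle (- v.1, v.2) (pi - theta).
Proof.
move=> [r r0 ->]; exists r => //=; rewrite cosB sinB cospi sinpi.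
by congr (_, _); ring.
Qed.

Lemma polar_angle_reflect_y v theta : polar_angle v theta ->
  polar_angle (v.1, - v.2) (0 - theta).
Proof. by move=> [r r0 ->]; exists r => //=; rewrite sub0r cosN sinN mulrN. Qed.

(** As [p] and [q] are not both even, translating time by half a period changes the
    sign of exactly one coordinate. *)
Lemma turns_lissajous_even A B (p q : nat) a b : coprime p q ->
  ~~ odd p || ~~ odd q -> (forall t, lissajous A B p q a b t != 0) ->
  turns (lissajous A B p q a b) = 0.
Proof.
move=> cpq pq_even u0.
have shift t : lissajous A B p q a b (t + 2^-1) =
    ((-1) ^+ p * (lissajous A B p q a b t).1,
     (-1) ^+ q * (lissajous A B p q a b t).2).
  by rewrite /lissajous !sin_half_period /=; congr (_, _); rewrite mulrCA.
have odd1 : odd p || odd q.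
  apply/negPn/negP; rewrite negb_or => /andP[ep eq].
  have : (2 %| gcdn p q)%N by rewrite dvdn_gcd !dvdn2 ep eq.
  by rewrite (eqP cpq).
pose c : R := if odd p then pi else 0.
apply: (@turns_reflection _ c) => // [|t theta ut]; first exact: continuous_lissajous.
rewrite shift -signr_odd -(signr_odd _ q) /c.
case: (odd p) (odd q) pq_even odd1 => -[]//= _ _; rewrite expr1 expr0 mulN1r mul1r.
  exact: polar_angle_reflect_x ut.
exact: polar_angle_reflect_y ut.
Qed.

(** The difference of phases [p * b - q * a] does not change under translations of
    time, and changes by multiples of pi when the signs of the coordinates do.
    Starting at a zero of the first coordinate leaves the second phase only. *)
Lemma lissajous_phase_shift A B (p q : nat) a b (k l : int) :
  (0 < p)%N -> (0 < q)%N ->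
  let t0 := (pi * k%:~R - a) / (2 * pi * p%:R) in
  let d := (p%:R * b - q%:R * a - pi * (p%:R * l%:~R - q%:R * k%:~R)) / p%:R in
  forall t, lissajous A B p q a b (t0 + t) =
            lissajous ((-1) ^ k * A) ((-1) ^ l * B) p q 0 d t.
Proof.
move=> p0 q0 t0 d t; have pi0 := pi_gt0 R.
have p0R : p%:R != 0 :> R by rewrite pnatr_eq0 -lt0n.
have pin0 : pi != 0 :> R by rewrite gt_eqF.
rewrite /lissajous; congr (_, _).
  have -> : 2 * pi * p%:R * (t0 + t) + a = 2 * pi * p%:R * t + 0 + pi * k%:~R.
    by rewrite /t0; move: (@pi R) pin0 => P P0; field; rewrite P0 p0R.
  by rewrite sin_addnpi mulrCA mulrA.
have -> : 2 * pi * q%:R * (t0 + t) + b = 2 * pi * q%:R * t + d + pi * l%:~R.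
  by rewrite /t0 /d; move: (@pi R) pin0 => P P0; field; rewrite P0 p0R.
by rewrite sin_addnpi mulrCA mulrA.
Qed.

(** By Bezout, integers [k] and [l] can be chosen so that the phase shift moves
    [p * b - q * a] into the interval from 0 to pi, at the cost of the sign
    (-1)^(k + l). The value 0 is excluded, for then the curve would meet the origin. *)
Lemma turns_lissajous_odd A B (p q : nat) a b : odd p -> odd q -> coprime p q ->
  (forall t, lissajous A B p q a b t != 0) ->
  sin (p%:R * b - q%:R * a) != 0 /\
  turns (lissajous A B p q a b) =
  - (Num.sg A * Num.sg B * Num.sg (sin (p%:R * b - q%:R * a))).
Proof.
move=> op oq cpq u0.
have p0 : (0 < p)%N by case: p op {cpq u0}.
have q0 : (0 < q)%N by case: q oq {cpq u0}.
have p0R : 0 < p%:R :> R by rewrite ltr0n.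
have [A0 B0] := lissajous_amplitude_neq0 p0 q0 u0.
have [n [y [DE /andP[y0 ypi]]]] := mod_pi (p%:R * b - q%:R * a).
have /coprimezP [[i j] /= ij] : coprimez p q by [].
pose l : int := n * i; pose k : int := - (n * j).
have kl : p%:Z * l - q%:Z * k = n.
  by rewrite /l /k -[RHS]mulr1 -ij; ring.
have klR : p%:R * l%:~R - q%:R * k%:~R = n%:~R :> R.
  by rewrite -kl intrB !intrM.
pose t0 : R := (pi * k%:~R - a) / (2 * pi * p%:R).
have sh t : lissajous A B p q a b (t0 + t) =
    lissajous ((-1) ^ k * A) ((-1) ^ l * B) p q 0 (y / p%:R) t.
  by rewrite (lissajous_phase_shift _ _ _ _ k l)// klR DE addrK.
have sgn1 (m : int) : (-1) ^ m != 0 :> R.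
  by rewrite expfz_neq0// oppr_eq0 oner_eq0.
(* For y = 0 both coordinates vanish at time t0. *)
have yn0 : y != 0.
  apply/eqP => y_eq; have := u0 (t0 + 0).
  by rewrite sh y_eq mul0r /lissajous mulr0 addr0 mulr0 addr0 sin0 !mulr0 eqxx.
have y_gt0 : 0 < y by rewrite lt_neqAle eq_sym yn0.
have sy : 0 < sin y by apply: sin_gt0_pi; rewrite y_gt0.
rewrite DE sin_addnpi; split; first by rewrite mulf_neq0// gt_eqF.
rewrite -(@turns_shift _ t0) //; first last.
- by move=> t; exact: lissajous_periodic.
- exact: continuous_lissajous.
have -> : (fun t => lissajous A B p q a b (t0 + t)) =
    lissajous ((-1) ^ k * A) ((-1) ^ l * B) p q 0 (y / p%:R).
  by apply/funext => t; exact: sh.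
rewrite turns_lissajous_in_phase//; first last.
- by move=> t; rewrite -sh.
- by rewrite (divr_gt0 y_gt0 p0R) /= ltr_pM2r ?invr_gt0.
- by rewrite mulf_neq0.
- by rewrite mulf_neq0.
rewrite !sgrM (gtr0_sg sy) mulr1.
have sgs (m : int) : Num.sg ((-1) ^ m) = (-1) ^ m :> R.
  by case: m => m; rewrite /exprz ?sgrV sgrX sgrN1 -?exprVn ?invrN1.
have oddp (r : nat) (m : int) : odd r -> (-1) ^ (r%:Z * m) = (-1) ^ m :> R.
  by move=> or; rewrite -exprz_exp -exprnP -signr_odd or expr1.
rewrite !sgs -kl expfzDr ?oppr_eq0 ?oner_eq0// oddp//.
rewrite -[- (q%:Z * k)]mulrN oddp//.
by rewrite -(exprz_inv _ k) invrN1; ring.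
Qed.

End Lissajous.

(** * Winding numbers of formations *)

Section Formations.
Variable R : realType.
Implicit Types (x y t tau : R).

Lemma sinB_sin x y :
  sin x - sin y = 2 * sin ((x - y) / 2) * sin ((x + y) / 2 + pi / 2).
Proof.
rewrite sinDpihalf.
have -> : sin x = sin ((x + y) / 2 + (x - y) / 2) by congr (sin _); field.
have -> : sin y = sin ((x + y) / 2 - (x - y) / 2) by congr (sin _); field.
by rewrite sinD sinB; ring.
Qed.

Section differences.
Variables (p q N : nat) (x0 y0 phx phy : R) (i j : 'I_N).
Let delta : R := (j.+1%:R - i.+1%:R) / N%:R.
Let mu : R := (j.+1%:R + i.+1%:R) / N%:R.

Lemma type_I_difference tau :
  @type_I R p q N x0 y0 phx phy tau j - @type_I R p q N x0 y0 phx phy tau i =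
  lissajous (2 * x0 * sin (pi * p%:R * delta))
    (2 * y0 * sin (pi * q%:R * delta)) p q
    (pi * p%:R * mu + phx + pi / 2) (pi * q%:R * mu + phy + pi / 2) tau.
Proof.
rewrite /type_I /lissajous /delta /mu; move: (N%:R^-1) => c.
by congr (_, _);
  rewrite /= -mulrBr sinB_sin ?[2 * x0]mulrC ?[2 * y0]mulrC -!mulrA;
  congr (_ * (_ * (sin _ * sin _))); move: (@pi R) => P; field.
Qed.

Lemma type_II_difference tau :
  @type_II R p q N x0 y0 phx phy tau j - @type_II R p q N x0 y0 phx phy tau i =
  lissajous (2 * x0 * sin (pi * delta)) (2 * y0 * sin (pi * delta)) p q
    (pi * mu + phx + pi / 2) (pi * mu + phy + pi / 2) tau.
Proof.
rewrite /type_II /lissajous /delta /mu; move: (N%:R^-1) => c.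
by congr (_, _);
  rewrite /= -mulrBr sinB_sin ?[2 * x0]mulrC ?[2 * y0]mulrC -!mulrA;
  congr (_ * (_ * (sin _ * sin _))); move: (@pi R) => P; field.
Qed.

End differences.

Lemma difference_neq0 N (M : R -> 'I_N -> R * R) i j tau :
  without_collisions M -> i != j -> M tau j - M tau i != 0.
Proof. by move=> Mc ij; rewrite subr_eq0; apply/eqP => /esym; exact: Mc. Qed.

(** The difference of two sines of equal frequency is a sine of that frequency. *)
Lemma difference_lissajous p q N x0 y0 phx phy (M : R -> 'I_N -> R * R) i j :
  M = @type_I R p q N x0 y0 phx phy \/ M = @type_II R p q N x0 y0 phx phy ->
  without_collisions M -> i != j ->
  exists A B a b, (fun tau => M tau j - M tau i) = lissajous A B p q a b /\
    forall t, lissajous A B p q a b t != 0.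
Proof.
move=> ME Mc ij; have D0 tau := difference_neq0 tau Mc ij.
suff [A [B [a [b DE]]]] : exists A B a b, forall tau,
    M tau j - M tau i = lissajous A B p q a b tau.
  by exists A, B, a, b; split=> [|t]; [exact/funext|rewrite -DE].
case: ME => ->.
  by eexists; eexists; eexists; eexists => tau; exact: type_I_difference.
by eexists; eexists; eexists; eexists => tau; exact: type_II_difference.
Qed.

Lemma winding_number_even p q N x0 y0 phx phy (M : R -> 'I_N -> R * R) i j :
  coprime p q -> ~~ odd p || ~~ odd q ->
  M = @type_I R p q N x0 y0 phx phy \/ M = @type_II R p q N x0 y0 phx phy ->
  without_collisions M -> i != j -> winding_number M i j = 0.
Proof.
move=> cpq pq_even ME Mc ij; rewrite /winding_number.
have [A [B [a [b [-> u0]]]]] := difference_lissajous ME Mc ij.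
exact: turns_lissajous_even.
Qed.

Lemma winding_number_odd p q N x0 y0 phx phy (M : R -> 'I_N -> R * R) i j :
  coprime p q -> odd p -> odd q ->
  M = @type_I R p q N x0 y0 phx phy \/ M = @type_II R p q N x0 y0 phx phy ->
  without_collisions M -> i != j ->
  winding_number M i j = 1 \/ winding_number M i j = -1.
Proof.
move=> cpq op oq ME Mc ij; rewrite /winding_number.
have [A [B [a [b [-> u0]]]]] := difference_lissajous ME Mc ij.
have [A0 B0] := lissajous_amplitude_neq0 (odd_gt0 op) (odd_gt0 oq) u0.
have [s0 ->] := turns_lissajous_odd op oq cpq u0.
have sg1 x : x != 0 -> Num.sg x = 1 \/ Num.sg x = -1.
  by case: sgrP => // _ _; [left|right].
by case: (sg1 _ A0) (sg1 _ B0) (sg1 _ s0) => -> [] -> [] ->;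
  rewrite ?mulrNN ?mulrN ?mulNr ?mulr1 ?opprK; (try by left); right.
Qed.

Definition sin_product (p q : nat) x : R :=
  sin (pi * p%:R * x) * sin (pi * q%:R * x).

(** Up to a positive factor, the part of a winding number that is common to all
    pairs of a Type I formation: the phase p b - q a of the difference of two points
    does not depend on the pair. *)
Definition handedness (p q : nat) (x0 y0 phx phy : R) : R :=
  - (x0 * y0 * sin (p%:R * (phy + pi / 2) - q%:R * (phx + pi / 2))).

Lemma winding_number_type_I p q N x0 y0 phx phy (i j : 'I_N) :
  coprime p q -> odd p -> odd q ->
  let M := @type_I R p q N x0 y0 phx phy in
  let W := handedness p q x0 y0 phx phy *
    sin_product p q ((j%:R - i%:R) / N%:R) in
  without_collisions M -> i != j -> W != 0 /\ winding_number M i j = Num.sg W.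
Proof.
move=> cpq op oq M W Mc ij; rewrite /winding_number.
have D0 tau := difference_neq0 tau Mc ij.
set w := turns _.
have ji : (j.+1%:R - i.+1%:R) / N%:R = (j%:R - i%:R) / N%:R :> R.
  by rewrite -!natr1 opprD addrACA subrr addr0.
pose A : R := 2 * x0 * sin (pi * p%:R * ((j%:R - i%:R) / N%:R)).
pose B : R := 2 * y0 * sin (pi * q%:R * ((j%:R - i%:R) / N%:R)).
pose mu : R := (j.+1%:R + i.+1%:R) / N%:R.
pose a := pi * p%:R * mu + phx + pi / 2.
pose b := pi * q%:R * mu + phy + pi / 2.
have DE tau : M tau j - M tau i = lissajous A B p q a b tau.
  by rewrite /M type_I_difference ji.
have wE : w = turns (lissajous A B p q a b) by congr turns; exact/funext.
have u0 t : lissajous A B p q a b t != 0 by rewrite -DE.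
have [A0 B0] := lissajous_amplitude_neq0 (odd_gt0 op) (odd_gt0 oq) u0.
have [s0 te] := turns_lissajous_odd op oq cpq u0.
have phase :
    p%:R * b - q%:R * a = p%:R * (phy + pi / 2) - q%:R * (phx + pi / 2).
  by rewrite /a /b; ring.
rewrite phase in s0 te.
have -> : W =
    - (A * B * sin (p%:R * (phy + pi / 2) - q%:R * (phx + pi / 2))) / 4.
  by rewrite /W /A /B /handedness /sin_product; field.
split.
  apply: mulf_neq0; last by rewrite invr_eq0 pnatr_eq0.
  by rewrite oppr_eq0; apply: mulf_neq0 s0; exact: mulf_neq0.
have sg4 : Num.sg (4^-1) = 1 :> R by rewrite gtr0_sg// invr_gt0 ltr0n.
by rewrite wE te !(sgrM, sgrN) sg4 mulr1.
Qed.

(** Multiplied by [2 * sin h], the sum telescopes. *)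
Lemma sum_cos_eq0 n h : sin h != 0 :> R -> sin (n%:R * h) = 0 ->
  \sum_(m < n) cos (2 * m%:R * h) = 0.
Proof.
move=> h0 nh0; have h2 : 2 * sin h != 0 by rewrite mulf_neq0// pnatr_eq0.
apply: (mulfI h2); rewrite mulr0 mulr_sumr.
pose f (m : nat) := sin (2 * m%:R * h - h).
have step (m : nat) : 2 * sin h * cos (2 * m%:R * h) = f m.+1 - f m.
  rewrite /f -[m.+1%:R]natr1.
  rewrite (_ : 2 * (m%:R + 1) * h - h = 2 * m%:R * h + h); last by ring.
  by rewrite sinD sinB; ring.
under eq_bigr do rewrite step.
rewrite -(big_mkord xpredT (fun m => f m.+1 - f m)) telescope_sumr// /f.
rewrite mulr0 mul0r sub0r sinN opprK.
rewrite -mulrA -[2]/(2%:R) mulr_natl mulr2n sinB sinD cosD nh0.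
by ring: (cos2sin2 (n%:R * h)) nh0.
Qed.

Lemma sin_pi_int (n : int) : sin (pi * n%:~R) = 0 :> R.
Proof. by rewrite -[pi * _]add0r sin_addnpi sin0 mulr0. Qed.

Lemma sin_frac_neq0 (s : int) N : (0 < N)%N -> ~ ((2 * N)%:Z %| s)%Z ->
  sin (pi * s%:~R / (2 * N%:R)) != 0 :> R.
Proof.
move=> N0 Ns; apply/eqP => /sin_eq0[n e]; apply: Ns; apply/dvdzP; exists n.
have pin0 : pi != 0 :> R by rewrite gt_eqF ?pi_gt0.
have Nn0 : 2 * N%:R != 0 :> R by rewrite mulf_neq0 ?pnatr_eq0// -lt0n.
move/(canRL (divfK Nn0)) : e; rewrite -mulrA => /(mulfI pin0) e.
by apply/eqP; rewrite -(eqr_int R) e intrM PoszM intrM.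
Qed.

Lemma sum_cos_frac (s : int) N : (0 < N)%N -> ~ ((2 * N)%:Z %| s)%Z ->
  (exists r, s = 2 * r) ->
  \sum_(m < N) cos (2 * m%:R * (pi * s%:~R / (2 * N%:R))) = 0 :> R.
Proof.
move=> N0 Ns [r sE]; apply: sum_cos_eq0; first exact: sin_frac_neq0.
rewrite -[RHS](sin_pi_int r); congr (sin _); rewrite sE intrM.
by field; rewrite pnatr_eq0 -lt0n.
Qed.

(** The product of sines is half the difference of the cosines of
    pi (q - p) m / N and pi (q + p) m / N; the sum of each over [m] vanishes. *)
Lemma sum_sin_product p q N : (0 < N)%N -> odd p -> odd q ->
  ~ ((2 * N)%:Z %| q%:Z - p%:Z)%Z -> ~ ((2 * N)%:Z %| q%:Z + p%:Z)%Z ->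
  \sum_(m < N) sin_product p q (m%:R / N%:R) = 0.
Proof.
move=> N0 op oq Nd Ns.
have half (r : nat) : odd r -> r%:Z = 2 * r./2%:Z + 1.
  move=> or; rewrite -[in LHS](odd_double_half r) or.
  by rewrite add1n -muln2 -addn1 PoszD PoszM mulrC.
have pE := half p op; have qE := half q oq.
have Sd := sum_cos_frac N0 Nd; have Ss := sum_cos_frac N0 Ns.
transitivity (2^-1 *
  (\sum_(m < N) cos (2 * m%:R * (pi * (q%:Z - p%:Z)%:~R / (2 * N%:R)))
   - \sum_(m < N) cos (2 * m%:R * (pi * (q%:Z + p%:Z)%:~R / (2 * N%:R)))) : R).
  rewrite -sumrB mulr_sumr; apply: eq_bigr => m _.
  pose x : R := pi * p%:R * (m%:R / N%:R).
  pose y : R := pi * q%:R * (m%:R / N%:R).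
  have Nn0 : N%:R != 0 :> R by rewrite pnatr_eq0 -lt0n.
  have -> : 2 * m%:R * (pi * (q%:Z - p%:Z)%:~R / (2 * N%:R)) = y - x.
    by rewrite intrB /x /y; move: (@pi R) => P; field; rewrite Nn0.
  have -> : 2 * m%:R * (pi * (q%:Z + p%:Z)%:~R / (2 * N%:R)) = y + x.
    by rewrite intrD /x /y; move: (@pi R) => P; field; rewrite Nn0.
  by rewrite /sin_product -/x -/y cosB cosD; field.
rewrite Sd ?Ss ?subrr ?mulr0//.
  by exists (q./2%:Z + p./2%:Z + 1); rewrite pE qE; ring.
by exists (q./2%:Z - p./2%:Z); rewrite pE qE; ring.
Qed.

(** If [q] is congruent to [p] or to [- p] modulo [2 * N], then the second sine is the
    first one or its opposite at every multiple of 1 / N. *)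
Lemma sin_product_congr p q N (i j : nat) (e : bool) : (0 < N)%N ->
  ((2 * N)%:Z %| q%:Z - (-1) ^+ e * p%:Z)%Z ->
  0 <= (-1) ^+ e * sin_product p q ((j%:R - i%:R) / N%:R).
Proof.
move=> N0 /dvdzP[k kE].
have qE : q%:R = (-1) ^+ e * p%:R + k%:~R * (2 * N%:R) :> R.
  have /(congr1 (fun z : int => z%:~R : R)) := kE.
  rewrite intrB !intrM rmorphXn /= intrN => /(canRL (subrK _)).
  by rewrite PoszM intrM addrC.
rewrite /sin_product qE; set x := pi * p%:R * _.
have -> : pi * ((-1) ^+ e * p%:R + k%:~R * (2 * N%:R)) *
    ((j%:R - i%:R) / N%:R) =
    (-1) ^+ e * x + pi * (2 * (k * (j%:Z - i%:Z)))%:~R.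
  rewrite /x !intrM intrB; move: (@pi R) => P; field.
  by rewrite pnatr_eq0 -lt0n.
rewrite sin_addnpi -exprz_exp -exprnP sqrrN expr1n exp1rz mul1r.
by case: e {kE qE};
  rewrite ?expr1 ?expr0 ?mulN1r ?mul1r ?sinN ?mulrN ?opprK -expr2; exact: sqr_ge0.
Qed.

Lemma sum_eq0_lt0 n (F : 'I_n -> R) i :
  \sum_(m < n) F m = 0 -> F i != 0 -> exists m, F m < 0.
Proof.
move=> F0 Fi; apply/existsP; apply: contraR Fi; rewrite negb_exists => /forallP Fge0.
apply/eqP; apply: (psumr_eq0P _ F0) => // m _; rewrite leNgt; exact: Fge0.
Qed.

Lemma sin_product0 p q : sin_product p q 0 = 0.
Proof. by rewrite /sin_product !mulr0 sin0 mul0r. Qed.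

(** For the pairs that contain the first point, the winding numbers are, up to a
    common sign, the signs of the terms with [m > 0] of a sum that vanishes, and
    these terms are nonzero. *)
Lemma type_I_both_signs p q N x0 y0 phx phy : (1 < N)%N ->
  coprime p q -> odd p -> odd q ->
  without_collisions (@type_I R p q N x0 y0 phx phy) ->
  ~ ((2 * N)%:Z %| q%:Z - p%:Z)%Z -> ~ ((2 * N)%:Z %| q%:Z + p%:Z)%Z ->
  forall s, s = 1 \/ s = -1 -> exists i j : 'I_N, i != j /\
    winding_number (@type_I R p q N x0 y0 phx phy) i j = s.
Proof.
move=> N1 cpq op oq Mc Nd Ns s s1; have N0 := ltnW N1.
pose i0 := Ordinal N0; pose H := handedness p q x0 y0 phx phy.
(* The factor [- s] turns the sign looked for into a negative value of [F]. *)
pose F (m : 'I_N) := - s * (H * sin_product p q (m%:R / N%:R)).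
have wi0 (m : 'I_N) : i0 != m -> H * sin_product p q (m%:R / N%:R) != 0 /\
    winding_number (@type_I R p q N x0 y0 phx phy) i0 m =
    Num.sg (H * sin_product p q (m%:R / N%:R)).
  by move=> i0m; have := winding_number_type_I cpq op oq Mc i0m; rewrite /= subr0.
have sn0 : s != 0 by case: s1 => ->; rewrite ?oppr_eq0 oner_eq0.
have [m Fm] : exists m, F m < 0.
  apply: (@sum_eq0_lt0 _ _ (Ordinal N1)).
    by rewrite -!mulr_sumr sum_sin_product ?mulr0.
  by rewrite mulf_neq0 ?oppr_eq0//; have [] := wi0 (Ordinal N1) isT.
have i0m : i0 != m.
  by apply/eqP => e; move: Fm; rewrite /F -e /= mul0r sin_product0 !mulr0 ltxx.
exists i0, m; split=> //; have [_ ->] := wi0 m i0m.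
move: Fm; rewrite /F; case: s1 => ->.
  by rewrite mulN1r oppr_lt0; exact: gtr0_sg.
by rewrite opprK mul1r; exact: ltr0_sg.
Qed.

Lemma type_I_same_sign p q N x0 y0 phx phy (e : bool) (i j : 'I_N) : (0 < N)%N ->
  coprime p q -> odd p -> odd q ->
  without_collisions (@type_I R p q N x0 y0 phx phy) ->
  ((2 * N)%:Z %| q%:Z - (-1) ^+ e * p%:Z)%Z -> i != j ->
  winding_number (@type_I R p q N x0 y0 phx phy) i j =
  (-1) ^+ e * Num.sg (handedness p q x0 y0 phx phy).
Proof.
move=> N0 cpq op oq Mc dvd ij.
have [] := winding_number_type_I cpq op oq Mc ij; rewrite mulf_eq0 negb_or.
move=> /andP[_ F0] ->; rewrite sgrM mulrC; congr (_ * _).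
have := sin_product_congr i j N0 dvd.
rewrite le_eqVlt eq_sym mulf_eq0 signr_eq0 (negbTE F0) /=.
move=> /gtr0_sg; rewrite sgrM sgrX sgrN1 => h.
by rewrite -[LHS](signrMK e) h mulr1.
Qed.

End Formations.

Theorem proposition2 (R : realType) (p q N : nat) (x0 y0 phx phy : R)
    (p_gt0 : (0 < p)%N) (q_gt0 : (0 < q)%N) (pq_coprime : coprime p q)
    (N_ge2 : (2 <= N)%N) (x0_neq0 : x0 != 0) (y0_neq0 : y0 != 0) :
  (forall M : R -> 'I_N -> R * R,
     M = @type_I R p q N x0 y0 phx phy \/ M = @type_II R p q N x0 y0 phx phy ->
     without_collisions M ->
     [/\ ~~ odd p || ~~ odd q ->
           forall i j : 'I_N, i != j -> winding_number M i j = 0,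
         odd p && odd q ->
           forall i j : 'I_N, i != j ->
             winding_number M i j = 1 \/ winding_number M i j = -1 &
         odd p && odd q -> weakly_entangled M])
  /\
  (forall M : R -> 'I_N -> R * R,
     M = @type_I R p q N x0 y0 phx phy ->
     without_collisions M ->
     odd p && odd q ->
     ((exists i j : 'I_N, i != j /\ winding_number M i j = 1) /\
      (exists i j : 'I_N, i != j /\ winding_number M i j = -1)
      <->
      ~ ((2 * N)%:Z %| q%:Z - p%:Z)%Z /\ ~ ((2 * N)%:Z %| q%:Z + p%:Z)%Z)
     /\
     (~ ((2 * N)%:Z %| q%:Z - p%:Z)%Z /\ ~ ((2 * N)%:Z %| q%:Z + p%:Z)%Z ->
      strongly_entangled M)).
Proof.
split.
  move=> M ME Mc; split=> [pq_even i j ij|/andP[op oq] i j ij|/andP[op oq]].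
  - exact: winding_number_even ME Mc ij.
  - exact: winding_number_odd ME Mc ij.
  have ij : Ordinal (ltnW N_ge2) != Ordinal N_ge2 by [].
  apply: (not_strongly_homotopic ij).
  by have [->|->] := winding_number_odd pq_coprime op oq ME Mc ij;
    rewrite ?oppr_eq0 oner_eq0.
move=> M -> Mc /andP[op oq]; have N0 := ltnW N_ge2.
have both := type_I_both_signs N_ge2 pq_coprime op oq Mc.
have neq1 : 1 != -1 :> R by apply/eqP; lra.
split; last first.
  move=> [Nd Ns].
  have [i [j [ij w]]] := both Nd Ns 1 (or_introl erefl).
  have [i' [j' [ij' w']]] := both Nd Ns (-1) (or_intror erefl).
  by apply: (not_weakly_homotopic ij ij'); rewrite w w'.
split=> [[[i [j [ij w]]] [i' [j' [ij' w']]]]|[Nd Ns]]; last first.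
  by split; apply: both => //; [left|right].
have same e k l :=
  @type_I_same_sign R p q N x0 y0 phx phy e k l N0 pq_coprime op oq Mc.
split=> dvd; move/eqP: neq1; apply; rewrite -w' -[LHS]w.
  by rewrite !(same false) ?expr0 ?mul1r.
by rewrite !(same true) ?expr1 ?mulN1r ?opprK.
Qed.
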